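(* (Normal Forms) Let $S$ be a left-handed skew Boolean intersection algebra and $X$ a finite non-empty subset of $S$. Let $\mathcal{E}$ and $\mathcal{F}$ be two admissible families of elementary elements over $X$ and let $e=\vee\mathcal{E}$ and $f=\vee\mathcal{F}$ be the respective normal forms over $X$. Let $\pi\colon S\to S/\mathcal{D}$ be the canonical projection. Then: (1) Any subfamily of $\mathcal{E}$ is admissible, as is the family $\{u\in\mathcal{E}\colon\pi(u)\notin\pi(\mathcal{F})\}\cup\mathcal{F}$. Moreover, the elements $e\vee f$, $e\wedge f$, $e\sqcap f$ and $e\setminus f$ can be written as normal forms over $X$, namely: $$e\vee f=\vee\{u\in\mathcal{E}\colon\pi(u)\notin\pi(\mathcal{F})\}\vee f,\qquad e\wedge f=\vee\{u\in\mathcal{E}\colon\pi(u)\in\pi(\mathcal{F})\},$$ $$e\setminus f=\vee\{u\in\mathcal{E}\colon\pi(u)\notin\pi(\mathcal{F})\},\qquad e\sqcap f=\vee(\mathcal{E}\cap\mathcal{F}).$$ (2) Any element of the subalgebra $\langle X\rangle$ generated by $X$ can be written as a normal form over $X$. (3) $e\leq f$ if and only if $\mathcal{E}\subseteq\mathcal{F}$. (4) $e=f$ if and only if $\mathcal{E}=\mathcal{F}$. (5) The algebra $\langle X\rangle$ is finite. (6) For any $x\in\langle X\rangle$, the atoms of $\langle X\rangle$ below $x$ are precisely the elements of $\mathcal{G}$, where $x=\vee\mathcal{G}$ is the normal form of $x$ ($\mathcal{G}$ admissible). (7) The elementary elements over $X$ which are not equal to zero are precisely the atoms of $\langle X\r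angle$.
   Context: A skew Boolean algebra (SBA) is an algebra $(S;\wedge,\vee,\setminus,0)$ of type $(2,2,2,0)$ satisfying: $\wedge$ and $\vee$ are associative; $x\vee(x\wedge y)=x=(y\wedge x)\vee x$ and $x\wedge(x\vee y)=x=(y\vee x)\wedge x$; $x\wedge(y\vee z)=(x\wedge y)\vee(x\wedge z)$ and $(y\vee z)\wedge x=(y\wedge x)\vee(z\wedge x)$; $x\vee 0=0\vee x=x$ and $x\wedge 0=0\wedge x=0$; $(x\setminus y)\wedge y=y\wedge(x\setminus y)=0$ and $(x\setminus y)\vee(x\wedge y\wedge x)=x=(x\wedge y\wedge x)\vee(x\setminus y)$; $x\wedge y\wedge z\wedge t=x\wedge z\wedge y\wedge t$. It is left-handed if also $x\wedge y\wedge x=x\wedge y$ and $x\vee y\vee x=y\vee x$. The natural partial order is: $x\leq y$ iff $x\wedge y=y\wedge x=x$. An SBA has intersections if any two elements $x,y$ have a greatest lower bound $x\sqcap y$ with respect to $\leq$; a (left-handed) skew Boolean intersection algebra (SBIA) is an algebra $(S;\wedge,\vee,\setminus,\sqcap,0)$ where $(S;\wedge,\vee,\setminus,0)$ is a (left-handed) SBA with intersections and $\sqcap$ is this meet operation. The relation $\mathcal{D}$ is given by $x\mathrel{\mathcal{D}}y$ iff $x\wedge y\wedge x=x$ and $y\wedge x\wedge y=y$; it is a congruence on $(S;\wedge,\vee,\setminus,0)$. The subalgebra $\langle X\rangle$ is taken in the signature $(\wedge,\vee,\setminus,\sqcap,0)$. An atom is a minimal non-zero element with respect to $\leq$. A partition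 $\alpha$ of a set is a partition into non-empty blocks; $A\in\alpha$ means $A$ is a block. Elementary elements: let $\alpha=\{A_1,\dots,A_k\}$ be a partition of a non-empty subset $Y$ of $X$, and $A\in\alpha$. For a finite non-empty $B\subseteq S$, $\sqcap B$ denotes the $\sqcap$-meet of all elements of $B$, and $s\setminus(\vee B)$ denotes $s\setminus(b_1\vee\dots\vee b_r)$ where $b_1,\dots,b_r$ are the elements of $B$ (this does not depend on the order); $s\setminus(\vee\varnothing)=s$. Put $p=(\sqcap A)\wedge(\sqcap A_1)\wedge\dots\wedge(\sqcap A_k)$ and $Q=(X\setminus Y)\cup\{\sqcap(A_i\cup A_j)\colon 1\leq i<j\leq k\}$ ($X\setminus Y$ is set difference). Then $e(X,\alpha,A)=p\setminus(\vee Q)$; these are the elementary elements over $X$, and $(X,\alpha)$ is the support of $e(X,\alpha,A)$. A family $\mathcal{E}$ of elementary elements over $X$ is admissible if all its elements are non-zero and $e(X,\alpha,A),e(X,\alpha,B)\in\mathcal{E}$ implies $A=B$ (at most one element with each support). Elements of an admissible family satisfy $u\wedge v=0$ for $u\neq v$, so their join $\vee\mathcal{E}$ does not depend on the order. A normal form over $X$ is an element written as $\vee\mathcal{E}$ with $\mathcal{E}$ an admissible family of elementary elements over $X$; $0$ is the normal form of the empty family. *)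

(* Defs.v *)
From HB Require Import structures.
From mathcomp Require Import all_boot generic_quotient.
From mathcomp Require Import finmap.
From mathcomp Require Import classical_sets cardinality.

Set Implicit Arguments.
Unset Strict Implicit.
Unset Printing Implicit Defensive.

Declare Scope sba_scope.
Delimit Scope sba_scope with sba.
Local Open Scope sba_scope.

Reserved Notation "x ⋏ y" (at level 40, left associativity).
Reserved Notation "x ⊓ y" (at level 40, left associativity).
Reserved Notation "x ⋎ y" (at level 50, left associativity).
Reserved Notation "x ∖ y" (at level 50, left associativity).
Reserved Notation "x ≼ y" (at level 70, no associativity).

HB.mixin Record isSkewBoolean S & Choice S := {
  sand : S -> S -> S;
  sor : S -> S -> S;
  sdiff : S -> S -> S;
  szero : S;
  sandA : associative sand;
  sorA : associative sor;
  sor_andKl : forall x y, sor x (sand x y) = x;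
  sor_andKr : forall x y, sor (sand y x) x = x;
  sand_orKl : forall x y, sand x (sor x y) = x;
  sand_orKr : forall x y, sand (sor y x) x = x;
  sandUr : forall x y z, sand x (sor y z) = sor (sand x y) (sand x z);
  sandUl : forall x y z, sand (sor y z) x = sor (sand y x) (sand z x);
  sorx0 : forall x, sor x szero = x;
  sor0x : forall x, sor szero x = x;
  sandx0 : forall x, sand x szero = szero;
  sand0x : forall x, sand szero x = szero;
  sdiff_andl : forall x y, sand (sdiff x y) y = szero;
  sdiff_andr : forall x y, sand y (sdiff x y) = szero;
  sdiff_orl : forall x y, sor (sdiff x y) (sand (sand x y) x) = x;
  sdiff_orr : forall x y, sor (sand (sand x y) x) (sdiff x y) = x;
  sand_normal : forall x y z t,
    sand (sand (sand x y) z) t = sand (sand (sand x z) y) t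
}.

#[short(type="sbaType")]
HB.structure Definition SkewBoolean := {S of Choice S & isSkewBoolean S}.

Notation "x ⋏ y" := (sand x y) : sba_scope.
Notation "x ⋎ y" := (sor x y) : sba_scope.
Notation "x ∖ y" := (sdiff x y) : sba_scope.

Section NaturalOrder.
Variable S : sbaType.
Implicit Types x y z : S.

Definition sle x y : bool := (x ⋏ y == x) && (y ⋏ x == x).

Definition srelD x y : bool := (x ⋏ y ⋏ x == x) && (y ⋏ x ⋏ y == y).

Lemma sandxx x : x ⋏ x = x.
Proof. by rewrite -{2}(sor_andKl x x) sand_orKl. Qed.

Lemma srelD_refl : reflexive srelD.
Proof. by move=> x; rewrite /srelD !sandxx eqxx. Qed.

Lemma srelD_sym : symmetric srelD.
Proof. by move=> x y; rewrite /srelD andbC. Qed.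

Lemma srelD_trans_half x y z :
  x ⋏ y ⋏ x = x -> y ⋏ z ⋏ y = y -> x ⋏ z ⋏ x = x.
Proof.
move=> xyx yzy.
have xE : x ⋏ z ⋏ y ⋏ x = x.
  have : x ⋏ (y ⋏ z ⋏ y) ⋏ x = x by rewrite yzy.
  rewrite !sandA (sand_normal x y z y) -(sandA (x ⋏ z) y y) sandxx.
  by [].
rewrite -{2}xE !sandA (sand_normal x z x z) sandxx.
by rewrite -(sandA x z z) sandxx.
Qed.

Lemma srelD_trans : transitive srelD.
Proof.
move=> y x z /andP[/eqP xy /eqP yx] /andP[/eqP yz /eqP zy].
by apply/andP; split; apply/eqP; apply: (@srelD_trans_half _ y).
Qed.

Canonical srelD_equiv := EquivRel srelD srelD_refl srelD_sym srelD_trans.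

End NaturalOrder.

Notation "x ≼ y" := (sle x y) : sba_scope.

(* S/D as a set: only membership in images under the projection is used. *)
Notation quoD S := {eq_quot (@srelD S)}%qT.

Definition piD (S : sbaType) (x : S) : quoD S := (\pi_(quoD S) x)%qT.

HB.mixin Record SkewBoolean_hasIntersections S & SkewBoolean S := {
  scap : S -> S -> S;
  scap_lel : forall x y : S, scap x y ≼ x;
  scap_ler : forall x y : S, scap x y ≼ y;
  scap_glb : forall x y z : S, z ≼ x -> z ≼ y -> z ≼ scap x y
}.

#[short(type="sbiaType")]
HB.structure Definition SkewBooleanIntersection :=
  {S of SkewBoolean S & SkewBoolean_hasIntersections S}.

Notation "x ⊓ y" := (scap x y) : sba_scope.

HB.mixin Record SkewBoolean_isLeftHanded S & SkewBoolean S := {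
  sand_left : forall x y : S, x ⋏ y ⋏ x = x ⋏ y;
  sor_left : forall x y : S, x ⋎ y ⋎ x = y ⋎ x
}.

#[short(type="lhsbiaType")]
HB.structure Definition LeftHandedSBIA :=
  {S of SkewBooleanIntersection S & SkewBoolean_isLeftHanded S}.

Section NormalForms.
Variable S : lhsbiaType.
Local Open Scope fset_scope.
Implicit Types (X A B E Q : {fset S}) (alpha : {fset {fset S}}) (x u : S).

(* Finite meets, products and joins below are taken in the enumeration order
   of the finite set. The order is immaterial: scap is commutative, sand is left
   normal in the left-handed case, x ∖ y depends only on the D-class of y, and
   distinct elements u, v of an admissible family satisfy u ⋏ v = 0, hence
   u ⋎ v = v ⋎ u. *)

(* There is no top element: the value szero on the empty set is junk, and only
   non-empty sets are ever used. *)
Definition fcapS B : S :=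
  if enum_fset B is x :: s then foldl scap x s else szero.

Definition fjoinS Q : S := \big[sor/szero]_(x <- Q) x.

Definition is_partition (Y : {fset S}) alpha : Prop :=
  [/\ fset0 \notin alpha, trivIfset alpha & fcover alpha = Y].

(* (X, alpha) is a support; the subset Y is recovered as fcover alpha. *)
Definition is_support X alpha : Prop :=
  exists Y : {fset S}, [/\ Y != fset0, Y `<=` X & is_partition Y alpha].

Definition elem_p alpha A : S :=
  foldl (fun p B => p ⋏ fcapS B) (fcapS A) (enum_fset alpha).

Definition elem_Q X alpha : {fset S} :=
  (X `\` fcover alpha) `|`
  [fset fcapS (B `|` C) | B in alpha, C in alpha & B != C].

Definition elem X alpha A : S := elem_p alpha A ∖ fjoinS (elem_Q X alpha).

Definition is_elementary X u : Prop :=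
  exists alpha A, [/\ is_support X alpha, A \in alpha & u = elem X alpha A].

(* A family of elementary elements is a set of elements of S; it is finite
   since X has finitely many supports. *)
Definition admissible X E : Prop :=
  [/\ forall u, u \in E -> is_elementary X u,
      forall u, u \in E -> u != szero
    & forall alpha A B, is_support X alpha -> A \in alpha -> B \in alpha ->
        elem X alpha A \in E -> elem X alpha B \in E -> A = B].

Definition is_normal_form X x : Prop :=
  exists2 E, admissible X E & x = fjoinS E.

Definition piD_image E : {fset quoD S} := [fset piD v | v in E].

Definition subalgebra (M : set S) : Prop :=
  M szero /\
  forall x y, M x -> M y -> [/\ M (x ⋏ y), M (x ⋎ y), M (x ∖ y) & M (x ⊓ y)].

Definition generated X : set S := smallest subalgebra [set` X]%classic.

Definition is_atom (M : set S) x : Prop :=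
  [/\ M x, x != szero & forall y, M y -> y != szero -> y ≼ x -> y = x].

End NormalForms.

(* Main.v *)
(* Right multiplication by w evaluates an element s at w, with value s ⋏ w.
   If w decides all x ⊓ y with x, y in X, then evaluation at w sends <X> into
   {0} together with the values of those x in X that are nonzero at w. A nonzero
   elementary element decides X, hence is an atom of <X>. Conversely, any nonzero
   s in <X> lies above some w deciding X; the set of x in X above w in S/D,
   partitioned by the values x ⋏ w, is the support of an elementary u >= w, and
   u ⊓ s, being nonzero, equals the atom u. So every element of <X> is the join
   of the nonzero elementary elements below it, and identities in <X> are
   checked on atoms. *)
Require Import Defs.
From mathcomp Require Import all_boot generic_quotient.
From mathcomp Require Import finmap.
From mathcomp Require Import boolp classical_sets cardinality.

Set Implicit Arguments.
Unset Strict Implicit.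
Unset Printing Implicit Defensive.

Local Open Scope sba_scope.
Local Open Scope fset_scope.

(** * The natural order and left normality *)

Section LeftHandedOrder.
Variable S : lhsbiaType.
Implicit Types (w x y z s t : S).

(** Left-handedness allows a further factor [x] on the right, and normality then swaps the two inner
    factors. *)
Lemma sandAC : right_commutative (@sand S).
Proof.
move=> x y z.
rewrite -(sandA x y) -(sandA x z) -(sand_left x (y ⋏ z)) -(sand_left x (z ⋏ y)).
by rewrite !sandA sand_normal.
Qed.

Lemma sandKK x y : x ⋏ y ⋏ y = x ⋏ y.
Proof. by rewrite -sandA sandxx. Qed.

Lemma sleP x y : reflect (x ⋏ y = x /\ y ⋏ x = x) (x ≼ y).
Proof. by apply: (iffP andP) => -[/eqP ? /eqP ?]. Qed.

Lemma sle_refl x : x ≼ x.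
Proof. by apply/sleP; rewrite sandxx. Qed.

Lemma sle_trans y x z : x ≼ y -> y ≼ z -> x ≼ z.
Proof.
move=> /sleP[xy yx] /sleP[yz zy]; apply/sleP; split.
  by rewrite -{1}xy -sandA yz.
by rewrite -{1}yx sandA zy.
Qed.

Lemma sle_anti x y : x ≼ y -> y ≼ x -> x = y.
Proof. by move=> /sleP[xy _] /sleP[_ xy']; rewrite -xy xy'. Qed.

Lemma sand_le x y : x ⋏ y ≼ x.
Proof. by apply/sleP; rewrite sand_left sandA sandxx. Qed.

Lemma sdiff_le x y : x ∖ y ≼ x.
Proof.
apply/sleP; split.
  by have := sand_orKl (x ∖ y) (x ⋏ y ⋏ x); rewrite sdiff_orl.
by have := sand_orKr (x ∖ y) (x ⋏ y ⋏ x); rewrite sdiff_orr.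
Qed.

Lemma sle0 x : x ≼ szero -> x = szero.
Proof. by move=> /sleP[<-]; rewrite sandx0. Qed.

Lemma sle_sandC t x y : x ≼ t -> y ≼ t -> x ⋏ y = y ⋏ x.
Proof. by move=> /sleP[_ {1}<-] /sleP[_ tx]; rewrite sandAC tx. Qed.

Lemma sand0C x y : x ⋏ y = szero -> y ⋏ x = szero.
Proof. by move=> xy0; rewrite -(sand_left y x) -sandA xy0 sandx0. Qed.

Lemma sor_eq0 x y : x ⋎ y = szero <-> x = szero /\ y = szero.
Proof.
split=> [xy0|[-> ->]]; last by rewrite sorx0.
by split; [rewrite -(sand_orKl x y)|rewrite -(sand_orKr y x)];
  rewrite xy0 ?sandx0 ?sand0x.
Qed.

(** The join is not symmetric: in general only the right argument lies below it, and of [x] the part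
    [x ∖ y] survives ([sdiff_le_or]). *)
Lemma sle_or2 x y : y ≼ x ⋎ y.
Proof.
by apply/sleP; rewrite sand_orKr -{1}(sor_left y x) -sorA sand_orKl.
Qed.

Lemma sdiff_orE x y : (x ∖ y) ⋎ (x ⋏ y) = x.
Proof. by rewrite -sand_left sdiff_orl. Qed.

Lemma sor_sdiff x y : (x ∖ y) ⋎ y = x ⋎ y.
Proof. by rewrite -{2}(sdiff_orE x y) -sorA sor_andKr. Qed.

Lemma sdiff_le_or x y : x ∖ y ≼ x ⋎ y.
Proof.
have /sleP[dx xd] := sdiff_le x y; apply/sleP; split.
  by rewrite -{1}dx -sandA sand_orKl.
by rewrite sandUl xd sdiff_andr sorx0.
Qed.

Lemma sdiff_eq0 x y : y ≼ x -> x ∖ y = szero -> y = x.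
Proof. by move=> /sleP[_ xy] d0; rewrite -(sdiff_orE x y) d0 sor0x xy. Qed.

Lemma sdiff_sandl x y w : w ⋏ y = szero -> w ⋏ (x ∖ y) = w ⋏ x.
Proof.
move=> wy; rewrite -{2}(sdiff_orE x y) sandUr (sandA w x) (sandAC w x) wy.
by rewrite sand0x sorx0.
Qed.

Lemma sdiff_sandr x y w : y ⋏ w = szero -> (x ∖ y) ⋏ w = x ⋏ w.
Proof.
by move=> yw; rewrite -{2}(sdiff_orE x y) sandUl -sandA yw sandx0 sorx0.
Qed.

(** The factors play different roles: [x] bounds [w] in the natural order, [y] only in S/D. *)
Lemma sle_sand w x y : w ≼ x ⋏ y <-> w ≼ x /\ w ⋏ y = w.
Proof.
split=> [wxy|[/sleP[wx xw] wy]].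
  have wx := sle_trans wxy (sand_le x y); split=> //.
  by case/sleP: wxy => E _; rewrite -{1}E !sandA sandKK -sandA.
by apply/sleP; rewrite sandA wx wy (sandAC x y) xw.
Qed.

Lemma sle_sdiff w x y : w ≼ x ∖ y <-> w ≼ x /\ w ⋏ y = szero.
Proof.
split=> [wxy|[/sleP[wx xw] wy]].
  split; first exact: sle_trans wxy (sdiff_le x y).
  by case/sleP: wxy => E _; rewrite -E -sandA sdiff_andl sandx0.
apply/sleP; rewrite sdiff_sandl // sdiff_sandr //.
exact: sand0C.
Qed.

Lemma sle_scap w x y : w ≼ x ⊓ y <-> w ≼ x /\ w ≼ y.
Proof.
split=> [H|[]]; last exact: scap_glb.
by split; apply: sle_trans H _; rewrite ?scap_lel ?scap_ler.
Qed.

Lemma scapxx x : x ⊓ x = x.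
Proof. by apply: sle_anti; [exact: scap_lel|apply/sle_scap; rewrite sle_refl]. Qed.

(* x ⋏ w is the value of x "at w". *)
Lemma scap_sand_congr w s t x y :
  s ⋏ w = x ⋏ w -> t ⋏ w = y ⋏ w -> (s ⊓ t) ⋏ w = (x ⊓ y) ⋏ w.
Proof.
(* Since [c = a ⋏ c], the value of [c] at [w] is [a ⋏ w ⋏ c = b ⋏ w ⋏ c], a restriction of [b]. *)
have below a b c : c ≼ a -> a ⋏ w = b ⋏ w -> c ⋏ w ≼ b.
  move=> /sleP[_ ac] ab; rewrite -ac (sandAC a) ab (sandAC b) -sandA.
  exact: sand_le.
suff H s' t' x' y' : s' ⋏ w = x' ⋏ w -> t' ⋏ w = y' ⋏ w ->
    (s' ⊓ t') ⋏ w ≼ (x' ⊓ y') ⋏ w.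
  by move=> sx ty; apply: sle_anti; apply: H.
move=> sx ty; apply/sle_sand; rewrite sandKK; split=> //.
by apply/sle_scap; split;
  [apply: below sx; exact: scap_lel|apply: below ty; exact: scap_ler].
Qed.

End LeftHandedOrder.

(** * Finite meets and joins *)

Section FiniteOperations.
Variable S : lhsbiaType.
Implicit Types (B C Q : {fset S}) (w x z u : S) (r : seq S).

Lemma le_foldl_scap z x r :
  z ≼ foldl scap x r <-> z ≼ x /\ {in r, forall y, z ≼ y}.
Proof.
elim: r x => [|y r IH] x /=; first by split=> [|[]].
rewrite IH sle_scap; split.
  by move=> [[zx zy] H]; split=> // t; rewrite inE => /predU1P[->//|/H].
move=> [zx H]; split; last by move=> t tr; apply: H; rewrite inE tr orbT.
by split=> //; apply: H; rewrite mem_head.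
Qed.

Lemma le_fcapS B z : B != fset0 -> z ≼ fcapS B <-> {in B, forall x, z ≼ x}.
Proof.
case/fset0Pn=> x0 x0B; rewrite /fcapS.
have memB x : x \in B = (x \in enum_fset B) by [].
have := memB; rewrite memB in x0B; case: (enum_fset B) x0B => [//|a l] _ {}memB.
rewrite le_foldl_scap; split.
  by move=> [za H] x; rewrite memB inE => /predU1P[->|/H].
move=> H; split; first by apply: H; rewrite memB mem_head.
by move=> x xl; apply: H; rewrite memB inE xl orbT.
Qed.

Lemma fcapS_le B x : x \in B -> fcapS B ≼ x.
Proof.
move=> xB; have B0 : B != fset0 by apply/fset0Pn; exists x.
exact: (le_fcapS (fcapS B) B0).1 (sle_refl _) x xB.
Qed.

Lemma fcapSU B C : B != fset0 -> C != fset0 ->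
  fcapS (B `|` C) = fcapS B ⊓ fcapS C.
Proof.
move=> B0 C0; have BC0 : B `|` C != fset0.
  by case/fset0Pn: B0 => x xB; apply/fset0Pn; exists x; rewrite inE xB.
apply: sle_anti.
  by apply/sle_scap; split; apply/le_fcapS => // x xB; apply: fcapS_le;
    rewrite inE xB ?orbT.
apply/le_fcapS => // x; rewrite inE => /orP[xB|xC].
  exact: sle_trans (scap_lel _ _) (fcapS_le xB).
exact: sle_trans (scap_ler _ _) (fcapS_le xC).
Qed.

Lemma sand_bigl w r :
  w ⋏ \big[sor/szero]_(x <- r) x = \big[sor/szero]_(x <- r) (w ⋏ x).
Proof.
exact: (big_morph (sand w) (fun x y => sandUr w x y) (sandx0 w)).
Qed.

Lemma sand_bigr w r :
  (\big[sor/szero]_(x <- r) x) ⋏ w = \big[sor/szero]_(x <- r) (x ⋏ w).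
Proof.
exact: (big_morph (sand^~ w) (fun x y => sandUl w x y) (sand0x w)).
Qed.

Lemma sand_fjoinS_eq0 w Q :
  w ⋏ fjoinS Q = szero <-> {in Q, forall q, w ⋏ q = szero}.
Proof.
rewrite /fjoinS sand_bigl /=; have memQ x : x \in Q = (x \in enum_fset Q) by [].
suff H r : \big[sor/szero]_(x <- r) (w ⋏ x) = szero <->
    {in r, forall q, w ⋏ q = szero} by exact: H.
elim: r => [|a r IH]; first by rewrite big_nil.
rewrite big_cons sor_eq0 IH; split.
  by move=> [wa H] x; rewrite inE => /predU1P[->|/H].
move=> H; split; first by apply: H; rewrite mem_head.
by move=> x xr; apply: H; rewrite inE xr orbT.
Qed.

Lemma fjoinS_le Q x : {in Q, forall q, q ≼ x} -> fjoinS Q ≼ x.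
Proof.
move=> Qx; rewrite /fjoinS big_seq; elim/big_rec: _ => [|q y qQ /sleP[yx xy]].
  by apply/sleP; rewrite sand0x sandx0.
have /sleP[qx xq] := Qx q qQ.
by apply/sleP; rewrite sandUl sandUr qx xq yx xy.
Qed.

(** Meant for multiplication by a member [u] of an orthogonal family; repetitions of [u] in [r] are
    absorbed by [u ⋎ u = u]. *)
Lemma big_sor_single (f : S -> S) u r : f u = u -> u \in r ->
  {in r, forall v, v != u -> f v = szero} -> \big[sor/szero]_(v <- r) f v = u.
Proof.
move=> fu ur H.
suff: \big[sor/szero]_(v <- r) f v = if u \in r then u else szero by rewrite ur.
elim: r H {ur} => [|a r IH] H; first by rewrite big_nil.
rewrite big_cons IH => [|v vr]; last by apply: H; rewrite inE vr orbT.
rewrite inE; have [<-|ua] := eqVneq u a; last first.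
  by rewrite (H a) ?sor0x // ?mem_head // eq_sym.
by rewrite fu /=; case: ifP => _; rewrite ?sorx0 // -{2}(sandxx u) sor_andKl.
Qed.

End FiniteOperations.

(** * Values at [w] and the supports they determine *)

Section Germs.
Variable S : lhsbiaType.
Implicit Types (X Q : {fset S}) (alpha : {fset {fset S}}) (w x y s t : S).

Lemma scapC x y : x ⊓ y = y ⊓ x.
Proof. by apply: sle_anti; apply/sle_scap; rewrite scap_lel scap_ler. Qed.

Lemma sand_fix_le w x y : x ≼ y -> w ⋏ x = w -> w ⋏ y = w.
Proof. by move=> /sleP[xy _] wx; rewrite -{1}wx -sandA xy. Qed.

Lemma sand0_le w x y : x ≼ y -> w ⋏ y = szero -> w ⋏ x = szero.
Proof. by move=> /sleP[_ yx] wy; rewrite -yx sandA wy sand0x. Qed.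

(** If [w ⋏ (x ⊓ y) = w], both [x] and [y] take the value of [x ⊓ y] at [w]. Conversely, equal
    values allow [x ⊓ y] to be replaced by [x ⊓ x] at [w]. *)
Lemma sand_fix_scap w x y :
  w ⋏ (x ⊓ y) = w <-> w ⋏ x = w /\ x ⋏ w = y ⋏ w.
Proof.
split=> [wxy|[wx xy]].
  split; first exact: sand_fix_le (scap_lel x y) wxy.
  have eval a b : w ⋏ (a ⊓ b) = w -> a ⋏ w = (a ⊓ b) ⋏ w.
    move=> wab; rewrite -{1}wab sandA sandAC.
    by case/sleP: (scap_lel a b) => _ ->.
  by have := eval y x; rewrite (scapC y x) (eval x y) // => ->.
have E : (x ⊓ y) ⋏ w = x ⋏ w.
  by rewrite (scap_sand_congr (erefl _) (esym xy)) scapxx.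
by rewrite -sand_left -sandA E sandA sand_left.
Qed.

(* For y = x: w is either disjoint from x or below x in S/D. *)
Definition decides X w : Prop := forall x y, x \in X -> y \in X ->
  w ⋏ (x ⊓ y) = szero \/ w ⋏ (x ⊓ y) = w.

Lemma subalgebra_generated X : subalgebra (generated X).
Proof.
split=> [M [[M0 _] _]//|x y gx gy].
by split=> M HM; have [[_ MM] _] := HM; have [] := MM _ _ (gx M HM) (gy M HM).
Qed.

Lemma mem_generated X x : x \in X -> generated X x.
Proof. by move=> xX M [_]; apply. Qed.

Lemma generated_ind X (M : set S) : subalgebra M -> (forall x, x \in X -> M x) ->
  forall s, generated X s -> M s.
Proof. by move=> HM XM s; apply; split. Qed.

(** At [w], each operation returns zero or the value of one of its arguments, so the elements with
    this property form a subalgebra. *)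
Lemma decides_generated X w s : decides X w -> generated X s ->
  s ⋏ w = szero \/ exists2 x, x \in X & w ⋏ x = w /\ s ⋏ w = x ⋏ w.
Proof.
move=> dec; pose M t := t ⋏ w = szero \/
  exists2 x, x \in X & w ⋏ x = w /\ t ⋏ w = x ⋏ w.
apply: (generated_ind (M := M)) => {s} [|x xX]; last first.
  have [] := dec _ _ xX xX; rewrite scapxx; last by right; exists x.
  by move/sand0C; left.
split=> [|s t hs ht]; first by left; rewrite sand0x.
rewrite /M; split.
- case: ht => [t0|[x xX [wx tx]]]; first by left; rewrite -sandA t0 sandx0.
  rewrite -sandA tx sandA sandAC; case: hs => [->|[y yX [wy sy]]].
    by left; rewrite sand0x.
  by right; exists y => //; rewrite sy -sandA wx.
- rewrite sandUl; case: ht => [->|[x xX [wx tx]]]; first by rewrite sorx0.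
  right; exists x => //; split=> //; rewrite tx.
  case: hs => [->|[y yX [wy sy]]]; first by rewrite sor0x.
  suff {1}-> : s ⋏ w = s ⋏ w ⋏ (x ⋏ w) by rewrite sor_andKr.
  by rewrite sandA -[in RHS](sandA s w x) wx sandKK.
- case: ht => [t0|[x xX [wx tx]]]; first by rewrite sdiff_sandr.
  (* Writing [w] as [w ⋏ x] brings [x ⋏ w], the value of [t], next to [s ∖ t], which annihilates
     [t]. *)
  by left; rewrite -{1}wx (sandA _ w) sandAC -sandA -tx sandA sdiff_andl sand0x.
- case: hs => [s0|[x xX [wx sx]]].
    by left; apply/sand0C/(sand0_le (scap_lel _ _))/sand0C.
  case: ht => [t0|[y yX [wy ty]]].
    by left; apply/sand0C/(sand0_le (scap_ler _ _))/sand0C.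
  rewrite (scap_sand_congr sx ty); have [/sand0C|] := dec _ _ xX yX; first by left.
  move=> /sand_fix_scap[_ xy]; right; exists x => //; split=> //.
  by rewrite -(scap_sand_congr (erefl (x ⋏ w)) xy) scapxx.
Qed.

(** The part of [w ≼ elem X alpha A] that depends on the support alone; it constrains only the class
    of [w] in S/D. *)
Definition realizes X alpha w : Prop :=
  {in alpha, forall C, w ⋏ fcapS C = w} /\
  {in elem_Q X alpha, forall q, w ⋏ q = szero}.

Lemma le_elem X alpha A w :
  w ≼ elem X alpha A <-> w ≼ fcapS A /\ realizes X alpha w.
Proof.
rewrite /elem sle_sdiff sand_fjoinS_eq0.
suff -> : w ≼ elem_p alpha A <->
   w ≼ fcapS A /\ {in alpha, forall C, w ⋏ fcapS C = w} by rewrite /realizes; tauto.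
rewrite /elem_p; have memE C : C \in alpha = (C \in enum_fset alpha) by [].
suff H r a : w ≼ foldl (fun p B => p ⋏ fcapS B) a r <->
   w ≼ a /\ {in r, forall C, w ⋏ fcapS C = w} by exact: H.
elim: r a => [|C r IH] a /=; first by split=> [|[]].
rewrite IH sle_sand; split.
  by move=> [[wa wC] H]; split=> // D; rewrite inE => /predU1P[->|/H].
move=> [wa H]; split; last by move=> D Dr; apply: H; rewrite inE Dr orbT.
by split=> //; apply: H; rewrite mem_head.
Qed.

(** If [w] realizes [alpha], then [fcapS A ⋏ w] lies below the elementary element and is D-related
    to [w]. The right side does not mention [A]: elementary elements with the same support are
    D-related. *)
Lemma realizesP X alpha A w : A \in alpha ->
  w ⋏ elem X alpha A = w <-> realizes X alpha w.
Proof.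
move=> Aalpha; split=> [wE|[wal wQ]].
  have [_ [eal eQ]] := (le_elem X alpha A _).1 (sle_refl _).
  split=> [C Cal|q qQ]; rewrite -wE -sandA.
    by rewrite eal.
  by rewrite eQ ?sandx0.
have wA := wal A Aalpha.
have /sleP[H _] : fcapS A ⋏ w ≼ elem X alpha A.
  apply/le_elem; split; first exact: sand_le.
  by split=> [C Cal|q qQ]; rewrite -sandA ?wal ?wQ ?sandx0.
have E : w ⋏ (fcapS A ⋏ w) = w by rewrite sandA sand_left.
by rewrite -{1}E -sandA H.
Qed.

Lemma realizes_elem X alpha A : realizes X alpha (elem X alpha A).
Proof. by case: ((le_elem X alpha A _).1 (sle_refl _)). Qed.

Definition germ_block X w x : {fset S} :=
  [fset y in X | (w ⋏ y == w) && (y ⋏ w == x ⋏ w)].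

(** The only support that a nonzero [w] can realize, by [realizes_partition]. *)
Definition germ_partition X w : {fset {fset S}} :=
  [fset germ_block X w x | x in X & w ⋏ x == w].

Lemma mem_germ_block X w x y :
  reflect [/\ y \in X, w ⋏ y = w & y ⋏ w = x ⋏ w] (y \in germ_block X w x).
Proof.
rewrite !inE; apply: (iffP and3P) => -[yX]; first by move=> /eqP ? /eqP.
by move=> -> ->; rewrite yX !eqxx.
Qed.

Lemma germ_partitionP X w B :
  reflect (exists2 x, x \in X /\ w ⋏ x = w & B = germ_block X w x)
    (B \in germ_partition X w).
Proof.
apply: (iffP (imfsetP _ _ _ _)) => -[x].
  by rewrite !inE => /andP[xX /eqP wx] ->; exists x.
by move=> [xX wx] ->; exists x; rewrite // !inE xX wx eqxx.
Qed.

Lemma fcover_mem alpha x :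
  reflect (exists2 B, B \in alpha & x \in B) (x \in fcover alpha).
Proof.
apply: (iffP (bigfcupP _ _ _ _)) => -[B].
  by rewrite andbT => ? ?; exists B.
by move=> ? ?; exists B; rewrite ?andbT.
Qed.

Lemma mem_elem_Q X alpha q :
  q \in elem_Q X alpha <-> (q \in X /\ q \notin fcover alpha) \/
    exists B C, [/\ B \in alpha, C \in alpha, B != C & q = fcapS (B `|` C)].
Proof.
rewrite /elem_Q in_fsetU in_fsetD; split.
  move=> /orP[/andP[]|/imfset2P[B Bal [C]]]; first by left.
  by rewrite !inE /= => /andP[Cal BC] ->; right; exists B, C.
move=> [[-> ->]//|[B [C [Bal Cal BC ->]]]]; apply/orP; right.
by apply/imfset2P; exists B => //; exists C; rewrite // !inE /= Cal.
Qed.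

(** * Recovering a support from an element realizing it *)

Section Support.
Variables (X : {fset S}) (alpha : {fset {fset S}}).
Hypothesis supp : is_support X alpha.

Lemma support_sub B x : B \in alpha -> x \in B -> x \in X.
Proof.
case: supp => Y [_ /fsubsetP YX [_ _ cY]] Bal xB; apply: YX; rewrite -cY.
by apply/fcover_mem; exists B.
Qed.

Lemma support_neq0 B : B \in alpha -> B != fset0.
Proof.
by case: supp => Y [_ _ [n0 _ _]] Bal; apply: contraNneq n0 => <-.
Qed.

Variable w : S.
Hypothesis real : realizes X alpha w.

Lemma realizes_fix B x : B \in alpha -> x \in B -> w ⋏ x = w.
Proof. by move=> Bal xB; apply: sand_fix_le (fcapS_le xB) _; apply: real.1. Qed.

Lemma realizes_germ B x : B \in alpha -> x \in B -> x ⋏ w = fcapS B ⋏ w.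
Proof.
move=> Bal xB; rewrite -{1}(real.1 B Bal) sandA sandAC.
by case/sleP: (fcapS_le xB) => _ ->.
Qed.

Lemma realizes_outside x : x \in X -> x \notin fcover alpha -> w ⋏ x = szero.
Proof. by move=> xX xn; apply: real.2; apply/mem_elem_Q; left. Qed.

(** At [w], [x] and [y] take the values of the meets of their blocks, and the [⊓] of these two meets
    belongs to [elem_Q]. *)
Lemma realizes_cross B C x y : B \in alpha -> C \in alpha -> B != C ->
  x \in B -> y \in C -> w ⋏ (x ⊓ y) = szero.
Proof.
move=> Bal Cal BC xB yC; apply: sand0C.
rewrite (scap_sand_congr (realizes_germ Bal xB) (realizes_germ Cal yC)).
rewrite -fcapSU ?support_neq0 //; apply: sand0C; apply: real.2.
by apply/mem_elem_Q; right; exists B, C.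
Qed.

Lemma realizes_decides : decides X w.
Proof.
move=> x y xX yX.
have [/fcover_mem[B Bal xB]|xn] := boolP (x \in fcover alpha); last first.
  by left; apply: sand0_le (scap_lel _ _) (realizes_outside xX xn).
have [/fcover_mem[C Cal yC]|yn] := boolP (y \in fcover alpha); last first.
  by left; apply: sand0_le (scap_ler _ _) (realizes_outside yX yn).
have [BC|BC] := eqVneq B C; last by left; apply: realizes_cross xB yC.
right; apply/sand_fix_scap; rewrite (realizes_fix Bal xB).
by rewrite (realizes_germ Bal xB) (realizes_germ Cal yC) BC.
Qed.

(** Elements of [X] outside the cover are annihilated by [w]. Equal values at [w] in different
    blocks would force [w] to be zero, by [realizes_cross] and [sand_fix_scap]. *)
Lemma realizes_partition : w != szero -> alpha = germ_partition X w.
Proof.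
move=> w0; have blockE B x : B \in alpha -> x \in B -> B = germ_block X w x.
  move=> Bal xB; apply/fsetP => y; apply/idP/mem_germ_block => [yB|[yX wy yx]].
    rewrite (support_sub Bal yB) (realizes_fix Bal yB).
    by rewrite (realizes_germ Bal yB) (realizes_germ Bal xB).
  have [/fcover_mem[C Cal yC]|yn] := boolP (y \in fcover alpha); last first.
    by rewrite -wy (realizes_outside yX yn) eqxx in w0.
  have [->//|BC] := eqVneq B C.
  have := realizes_cross Bal Cal BC xB yC.
  have /sand_fix_scap -> : w ⋏ x = w /\ x ⋏ w = y ⋏ w.
    by rewrite (realizes_fix Bal xB).
  by move=> wE; rewrite wE eqxx in w0.
apply/fsetP => B; apply/idP/germ_partitionP => [Bal|[x [xX wx] ->]].
  have /fset0Pn[x xB] := support_neq0 Bal; exists x; last exact: blockE.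
  by rewrite (support_sub Bal xB) (realizes_fix Bal xB).
have [/fcover_mem[C Cal xC]|xn] := boolP (x \in fcover alpha).
  by rewrite -(blockE C x).
by rewrite -wx (realizes_outside xX xn) eqxx in w0.
Qed.

End Support.

Lemma germ_partition_support X w : {in X, forall x, w ⋏ x = w ->
  is_support X (germ_partition X w)}.
Proof.
move=> x xX wx; have in_block y : y \in X -> w ⋏ y = w -> y \in germ_block X w y.
  by move=> yX wy; apply/mem_germ_block.
exists (fcover (germ_partition X w)); split.
- apply/fset0Pn; exists x; apply/fcover_mem; exists (germ_block X w x).
    by apply/germ_partitionP; exists x.
  exact: in_block.
- apply/fsubsetP => y /fcover_mem[_ /germ_partitionP[z _ ->]].
  by case/mem_germ_block.
- split=> //.
    apply/negP => /germ_partitionP[y [yX wy] E].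
    by have := in_block y yX wy; rewrite -E in_fset0.
  apply/trivIfsetP => _ _ /germ_partitionP[y _ ->] /germ_partitionP[z _ ->].
  move=> yz; apply/fdisjointP => t /mem_germ_block[_ _ ty].
  apply/negP => /mem_germ_block[_ _ tz].
  by case/eqP: yz; rewrite /germ_block -ty tz.
Qed.

Lemma decides_realizes X w : decides X w ->
  realizes X (germ_partition X w) w.
Proof.
move=> dec; split=> [_ /germ_partitionP[x [xX wx] ->]|q].
  (* All members of the block share the value [x ⋏ w], which is thus a lower bound of the block. *)
  have : x ⋏ w ≼ fcapS (germ_block X w x).
    apply/le_fcapS.
      by apply/fset0Pn; exists x; apply/mem_germ_block.
    by move=> y /mem_germ_block[_ _ <-]; exact: sand_le.
  have E : w ⋏ (x ⋏ w) = w by rewrite sandA sand_left.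
  by move=> /sleP[H _]; rewrite -{1}E -sandA H E.
move=> /mem_elem_Q[[qX qn]|[_ [_ [/germ_partitionP[x [xX wx] ->]
    /germ_partitionP[y [yX wy] ->] xy ->]]]].
  have [] := dec q q qX qX; rewrite scapxx // => wq.
  case/fcover_mem: qn; exists (germ_block X w q).
    by apply/germ_partitionP; exists q.
  exact/mem_germ_block.
have in_block z : z \in X -> w ⋏ z = w -> z \in germ_block X w z.
  by move=> zX wz; apply/mem_germ_block.
have [wxy|/sand_fix_scap[_ E]] := dec x y xX yX.
  apply: sand0_le wxy; apply/sle_scap; split; apply: fcapS_le; rewrite in_fsetU.
    by rewrite in_block.
  by rewrite orbC in_block.
by case/eqP: xy; rewrite /germ_block E.
Qed.

(** An element annihilating [q] is kept, any other is multiplied by [q] on the right; right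
    commutativity preserves earlier decisions. *)
Lemma decides_refine (r : seq S) w : w != szero -> exists w', [/\ w' != szero,
  w' ≼ w & {in r, forall q, w' ⋏ q = szero \/ w' ⋏ q = w'}].
Proof.
elim: r w => [|a r IH] w w0; first by exists w; rewrite sle_refl.
have [w' [w'0 w'w Hr]] := IH w w0.
have [wa|wa] := eqVneq (w' ⋏ a) szero.
  by exists w'; split=> // q; rewrite inE => /predU1P[->|/Hr //]; left.
exists (w' ⋏ a); split=> // [|q]; first exact: sle_trans (sand_le _ _) w'w.
rewrite inE => /predU1P[->|/Hr[E|E]]; first by right; rewrite sandKK.
  by left; rewrite sandAC E sand0x.
by right; rewrite sandAC E.
Qed.

(** * Subalgebras contain finite meets, joins and elementary elements *)

Section SubalgebraClosure.
Variable M : set S.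
Hypothesis subM : subalgebra M.

Lemma subalgebra_fcapS Q : (forall x, x \in Q -> M x) -> M (fcapS Q).
Proof.
rewrite /fcapS => MQ; have {}MQ x : x \in enum_fset Q -> M x by exact: MQ.
case: (enum_fset Q) MQ => [|a l] Ml; first exact: subM.1.
have := Ml a (mem_head _ _).
have {}Ml x : x \in l -> M x by move=> xl; apply: Ml; rewrite inE xl orbT.
elim: l a Ml => [//|b l IH] a Ml Ma /=; apply: IH => [x xl|].
  by apply: Ml; rewrite inE xl orbT.
by have [] := subM.2 _ _ Ma (Ml b (mem_head _ _)).
Qed.

Lemma subalgebra_fjoinS Q : (forall x, x \in Q -> M x) -> M (fjoinS Q).
Proof.
move=> MQ; rewrite /fjoinS big_seq; elim/big_rec: _ => [|x y xQ My].
  exact: subM.1.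
by have [] := subM.2 _ _ (MQ x xQ) My.
Qed.

Lemma subalgebra_elem X alpha A : (forall x, x \in X -> M x) ->
  is_support X alpha -> A \in alpha -> M (elem X alpha A).
Proof.
move=> MX supp Aal.
have Mcap B : B \in alpha -> M (fcapS B).
  by move=> Bal; apply: subalgebra_fcapS => x xB; apply/MX/(support_sub supp Bal).
suff Mp : M (elem_p alpha A).
  have [] // := subM.2 _ _ Mp (subalgebra_fjoinS (Q := elem_Q X alpha) _).
  move=> q /mem_elem_Q[[/MX]//|[B [C [Bal Cal _ ->]]]].
  apply: subalgebra_fcapS => x; rewrite in_fsetU.
  by move=> /orP[/(support_sub supp Bal)/MX|/(support_sub supp Cal)/MX].
rewrite /elem_p; have {}Aal := Mcap A Aal.
have {}Mcap B : B \in enum_fset alpha -> M (fcapS B) by exact: Mcap.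
elim: (enum_fset alpha) (fcapS A) Aal Mcap => [//|B r IH] a Ma Mr /=.
apply: IH => [|C Cr]; last by apply: Mr; rewrite inE Cr orbT.
by have [] := subM.2 _ _ Ma (Mr B (mem_head _ _)).
Qed.

End SubalgebraClosure.

(** * Elementary elements as atoms of the generated subalgebra *)

Lemma generated_elementary X u : is_elementary X u -> generated X u.
Proof.
move=> [alpha [A [supp Aal ->]]].
by apply: subalgebra_elem => // [|x]; [exact: subalgebra_generated|exact: mem_generated].
Qed.

Lemma elementary_atom X u : is_elementary X u -> u != szero ->
  is_atom (generated X) u.
Proof.
move=> elu u0; split=> [|//|y gy y0 yu]; first exact: generated_elementary.
have [alpha [A [supp Aal uE]]] := elu.
have real := realizes_elem X alpha A; rewrite -uE in real.
case/sleP: (yu) => yuy uyy.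
have [yu0|[x xX [ux]]] := decides_generated (realizes_decides supp real) gy.
  by rewrite -yuy yu0 eqxx in y0.
(* From [y = x ⋏ u] follows [u ⋏ y = u ⋏ x ⋏ u = u], whereas [u ⋏ y = y] because [y ≼ u]. *)
by rewrite yuy => yE; rewrite -[RHS]ux -sand_left -sandA -yE.
Qed.

Lemma elementary_below X s : generated X s -> s != szero ->
  exists u, [/\ is_elementary X u, u != szero & u ≼ s].
Proof.
move=> gs s0; have [w [w0 ws Hw]] := decides_refine [seq x ⊓ y | x <- X, y <- X] s0.
have dec : decides X w.
  by move=> x y xX yX; apply: Hw; apply/allpairsP; exists (x, y).
have /sleP[_ sw] := ws.
have [E|[x xX [wx]]] := decides_generated dec gs.
  by rewrite -sw E eqxx in w0.
(* [x] takes at [w] the same value as [s], namely [w] itself, so every member of its block [A] lies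
   above [w]. *)
rewrite sw => wE; set A := germ_block X w x.
have Aal : A \in germ_partition X w by apply/germ_partitionP; exists x.
have supp := germ_partition_support xX wx.
set u := elem X (germ_partition X w) A.
have elu : is_elementary X u by exists (germ_partition X w), A.
have wu : w ≼ u.
  apply/le_elem; split; last exact: decides_realizes.
  apply/le_fcapS; first by apply/fset0Pn; exists x; apply/mem_germ_block.
  by move=> y /mem_germ_block[_ wy yx]; apply/sleP; rewrite yx -wE.
have u0 : u != szero by apply: contraNneq w0 => uE; apply/eqP/sle0; rewrite -uE.
exists u; split=> //; have [gu _ atomu] := elementary_atom elu u0.
(* [s ⊓ u] lies below the atom [u] and above the nonzero [w], hence equals [u]. *)
rewrite -[X in X ≼ _](atomu (s ⊓ u)) ?scap_lel ?scap_ler //.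
  by have [] := (subalgebra_generated X).2 _ _ gs gu.
apply: contraNneq w0 => E; apply/eqP/sle0; rewrite -E.
by apply/sle_scap.
Qed.

End Germs.

(** * Admissible families and the normal forms they give *)

Section AdmissibleFamilies.
Variables (S : lhsbiaType) (X : {fset S}).
Implicit Types (E F G : {fset S}) (u v a x y : S).

Definition nonzero_elementary u : Prop := is_elementary X u /\ u != szero.

Lemma nonzero_elementary_sand u x : nonzero_elementary u -> generated X x ->
  u ⋏ x = szero \/ u ⋏ x = u.
Proof.
move=> [elu u0] gx; have [gu _ atomu] := elementary_atom elu u0.
have [->|ux0] := eqVneq (u ⋏ x) szero; first by left.
right; apply: atomu => //; last exact: sand_le.
by have [] := (subalgebra_generated X).2 _ _ gu gx.
Qed.

Lemma nonzero_elementary_fixC u v : nonzero_elementary u -> nonzero_elementary v ->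
  u ⋏ v = u -> v ⋏ u = v.
Proof.
move=> [elu u0] nev uv.
have [/sand0C E|//] := nonzero_elementary_sand nev (generated_elementary elu).
by rewrite -uv E eqxx in u0.
Qed.

Lemma elem_sand_elem alpha A B : A \in alpha -> B \in alpha ->
  elem X alpha A ⋏ elem X alpha B = elem X alpha A.
Proof. by move=> Aal Bal; apply/realizesP => //; apply: realizes_elem. Qed.

(** For distinct blocks the common element would lie below the meet of their union, a member of
    [elem_Q] that it annihilates. *)
Lemma elem_inj alpha A B : is_support X alpha -> A \in alpha -> B \in alpha ->
  elem X alpha A = elem X alpha B -> elem X alpha A != szero -> A = B.
Proof.
move=> supp Aal Bal AB n0; have [//|neqAB] := eqVneq A B.
have [uA [_ uQ]] := (le_elem X alpha A _).1 (sle_refl _).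
have [uB _] := (le_elem X alpha B _).1 (sle_refl _); rewrite -AB in uB.
have Q : fcapS (A `|` B) \in elem_Q X alpha by apply/mem_elem_Q; right; exists A, B.
have := (sle_scap _ _ _).2 (conj uA uB); rewrite -fcapSU ?(support_neq0 supp) //.
by move=> /sleP[]; rewrite uQ // => E _; rewrite -E eqxx in n0.
Qed.

(* Two non-zero elementary elements are D-related exactly when their supports
   agree, so admissibility does not depend on how elements are presented. *)
Lemma admissibleP E : admissible X E <->
  (forall u, u \in E -> nonzero_elementary u) /\
  (forall u v, u \in E -> v \in E -> u ⋏ v != szero -> u = v).
Proof.
split=> [[elE n0E uniqE]|[neE uniqE]]; last first.
  split=> [u /neE[]//|u /neE[]//|alpha A B supp Aal Bal AE BE].
  have [_ A0] := neE _ AE; apply: (elem_inj supp Aal Bal) => //.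
  by apply: uniqE => //; rewrite elem_sand_elem.
split=> [u uE|u v uE vE uv0]; first by split; [apply: elE|apply: n0E].
have [alpha [A [supA Aal uA]]] := elE u uE.
have [beta [B [supB Bbe vB]]] := elE v vE.
(* The nonzero element [u ⋏ v] realizes both supports, and [realizes_partition] recovers either one
   from it. *)
have realA : realizes X alpha (u ⋏ v).
  by apply/(realizesP X _ Aal); rewrite -uA sand_left.
have realB : realizes X beta (u ⋏ v).
  by apply/(realizesP X _ Bbe); rewrite -vB sandKK.
have ab : alpha = beta.
  by rewrite (realizes_partition supA realA uv0) (realizes_partition supB realB uv0).
rewrite uA vB -ab; congr elem; apply: (uniqE alpha) => //; rewrite ?ab // -?ab -?uA //.
by rewrite ab -vB.
Qed.

Lemma admissible_generated E : admissible X E -> generated X (fjoinS E).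
Proof.
move=> [elE _ _]; apply: (subalgebra_fjoinS (subalgebra_generated X)) => u /elE.
exact: generated_elementary.
Qed.

(** Orthogonality puts each member below the join. Conversely, an atom [u] below the join has a
    nonzero product with some member [v]; being D-related and below the same element, [u] and [v]
    coincide. *)
Lemma le_fjoinS E u : admissible X E -> nonzero_elementary u ->
  u ≼ fjoinS E <-> u \in E.
Proof.
move=> /admissibleP[neE uniqE] neu.
have mem_le v : v \in E -> v ≼ fjoinS E.
  move=> vE; have E0 t : t \in E -> t != v -> v ⋏ t = szero.
    by move=> tE tv; apply/eqP; apply: contraNT tv => /(uniqE _ _ vE tE)->.
  apply/sleP; split; rewrite /fjoinS ?sand_bigl ?sand_bigr.
    by apply: big_sor_single; rewrite ?sandxx.
  apply: (big_sor_single (f := sand^~ v)); rewrite ?sandxx // => t tE tv.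
  exact/sand0C/E0.
split=> [uE|]; last exact: mem_le.
have [uE0|[v vE uv0]] : u ⋏ fjoinS E = szero \/ exists2 v, v \in E & u ⋏ v != szero.
  have [/hasP[v vE uv]|/hasPn H] := boolP (has (fun v => u ⋏ v != szero) E).
    by right; exists v.
  by left; apply/sand_fjoinS_eq0 => v /H; rewrite negbK => /eqP.
  by case/sleP: uE neu => <- _ [_]; rewrite uE0 eqxx.
have nev := neE v vE; have gv := generated_elementary nev.1.
have [E0|uv] := nonzero_elementary_sand neu gv; first by rewrite E0 eqxx in uv0.
suff <- : v = u by [].
by rewrite -(nonzero_elementary_fixC neu nev uv) (sle_sandC (mem_le v vE) uE).
Qed.

Lemma piD_eqP u v : piD u = piD v <-> u ⋏ v = u /\ v ⋏ u = v.
Proof.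
rewrite -(sand_left u v) -(sand_left v u).
split=> [/eqquotP/andP[/eqP ? /eqP ?]//|[uv vu]].
by apply/eqquotP/andP; split; apply/eqP.
Qed.

(** Turns conditions in S/D into products: by atomicity, a nonzero [u ⋏ v] with [v] in [F] makes [u]
    and [v] D-related. *)
Lemma piD_imageP F u : (forall v, v \in F -> nonzero_elementary v) ->
  nonzero_elementary u -> (piD u \in piD_image F) = (u ⋏ fjoinS F != szero).
Proof.
move=> neF neu; apply/imfsetP/idP => [[v /= vF]|n0].
  move=> /piD_eqP[uv _].
  case: neu => _; apply: contraNneq => /sand_fjoinS_eq0 H.
  by rewrite -uv H.
have [/hasP[v vF uv]|/hasPn H] := boolP (has (fun v => u ⋏ v != szero) F).
  exists v => //; have nev := neF v vF.
  have [E|E] := nonzero_elementary_sand neu (generated_elementary nev.1).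
    by rewrite E eqxx in uv.
  by apply/piD_eqP; rewrite (nonzero_elementary_fixC neu nev E).
case/eqP: n0; apply/sand_fjoinS_eq0 => v /H; rewrite negbK => /eqP//.
Qed.

(** The partition condition is left out: a finite set containing all elementary elements
    suffices. *)
Definition elementary_fset : {fset S} :=
  [fset elem X alpha A | alpha in fpowerset (fpowerset X), A in fpowerset X].

Lemma mem_elementary_fset u : is_elementary X u -> u \in elementary_fset.
Proof.
move=> [alpha [A [supp Aal ->]]]; have subX B : B \in alpha -> B `<=` X.
  by move=> Bal; apply/fsubsetP => x; apply: (support_sub supp Bal).
apply/imfset2P; exists alpha; last by exists A; rewrite //= fpowersetE subX.
by rewrite /= fpowersetE; apply/fsubsetP => B Bal; rewrite fpowersetE subX.
Qed.

Definition atoms_below x : {fset S} :=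
  [fset u in elementary_fset | `[< nonzero_elementary u >] && (u ≼ x)].

Lemma mem_atoms_below x u :
  u \in atoms_below x <-> nonzero_elementary u /\ u ≼ x.
Proof.
rewrite !inE; split=> [/and3P[_ /asboolP]//|[neu ux]].
by apply/and3P; split=> //; [apply: mem_elementary_fset; case: neu|apply/asboolP].
Qed.

Lemma atoms_below_admissible x : admissible X (atoms_below x).
Proof.
apply/admissibleP; split=> [u /mem_atoms_below[]//|u v].
move=> /mem_atoms_below[neu ux] /mem_atoms_below[nev vx] uv0.
have gv := generated_elementary nev.1.
have [E|E] := nonzero_elementary_sand neu gv; first by rewrite E eqxx in uv0.
by rewrite -(nonzero_elementary_fixC neu nev E) -(sle_sandC ux vx).
Qed.

(** A nonzero [x ∖ y], with [y] the join, would lie above an elementary element that is one of those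
    joined and yet annihilates [y]. *)
Lemma fjoinS_atoms_below x : generated X x -> fjoinS (atoms_below x) = x.
Proof.
move=> gx; set y := fjoinS _.
have adm := atoms_below_admissible x; have gy := admissible_generated adm.
have yx : y ≼ x.
  by apply: fjoinS_le => u /mem_atoms_below[].
have [d0|d0] := eqVneq (x ∖ y) szero; first exact: sdiff_eq0.
have gd : generated X (x ∖ y) by have [] := (subalgebra_generated X).2 _ _ gx gy.
have [u [elu u0 /sle_sdiff[ux uy]]] := elementary_below gd d0.
have neu : nonzero_elementary u by [].
have /sleP[uE _] : u ≼ y by apply/le_fjoinS => //; apply/mem_atoms_below.
by rewrite -uE uy eqxx in u0.
Qed.

Lemma eq_atoms_below x y : generated X x -> generated X y ->
  (forall u, nonzero_elementary u -> u ≼ x <-> u ≼ y) -> x = y.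
Proof.
move=> gx gy H; rewrite -(fjoinS_atoms_below gx) -(fjoinS_atoms_below gy).
by congr fjoinS; apply/fsetP => u; apply/idP/idP;
  move=> /mem_atoms_below[neu] /(H u neu) le; apply/mem_atoms_below.
Qed.

Lemma atom_generatedP u : is_atom (generated X) u <-> nonzero_elementary u.
Proof.
split=> [[gu u0 atomu]|[elu u0]]; last exact: elementary_atom.
have [v [elv v0 vu]] := elementary_below gu u0.
by rewrite -(atomu v) //; apply: generated_elementary.
Qed.

(** In S/D the atom [u] is below [y] or disjoint from it. In the first case [y] overrides [x], which
    is why [x] enters only as [x ∖ y]. *)
Lemma le_sor u x y : nonzero_elementary u -> generated X y ->
  u ≼ x ⋎ y <-> u ≼ x ∖ y \/ u ≼ y.
Proof.
move=> neu gy; split=> [uxy|[le|le]]; first last.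
- exact: sle_trans le (sle_or2 x y).
- exact: sle_trans le (sdiff_le_or x y).
have [uy0|uy] := nonzero_elementary_sand neu gy; [left|right]; last first.
  by apply/sleP; split=> //; rewrite -(sle_sandC uxy (sle_or2 x y)).
apply/sle_sdiff; split=> //; case/sleP: uxy.
rewrite sandUr sandUl uy0 sorx0 (sand0C uy0) sorx0 => ux xu.
exact/sleP.
Qed.

End AdmissibleFamilies.

(** * Operations, order, finiteness and atoms through normal forms *)

Theorem theorem22 (S : lhsbiaType) (X : {fset S}) (hX : X != fset0)
    (E F : {fset S}) (hE : admissible X E) (hF : admissible X F) :
  let e := fjoinS E in
  let f := fjoinS F in
  let E_notin := [fset u in E | piD u \notin piD_image F] in
  let E_in := [fset u in E | piD u \in piD_image F] in
  (* (1) *)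
  ((forall E' : {fset S}, E' `<=` E -> admissible X E') /\
   admissible X (E_notin `|` F) /\
   [/\ e ⋎ f = fjoinS E_notin ⋎ f,
       e ⋎ f = fjoinS (E_notin `|` F),
       e ⋏ f = fjoinS E_in,
       e ∖ f = fjoinS E_notin
     & e ⊓ f = fjoinS (E `&` F)]) /\
  (* (2) *)
  (forall x : S, generated X x -> is_normal_form X x) /\
  (* (3) *)
  (e ≼ f <-> E `<=` F) /\
  (* (4) *)
  (e = f <-> E = F) /\
  (* (5) *)
  finite_set (generated X) /\
  (* (6) *)
  (forall (x : S) (G : {fset S}),
     generated X x -> admissible X G -> x = fjoinS G ->
     forall a : S, (is_atom (generated X) a /\ a ≼ x) <-> a \in G) /\
  (* (7) *)
  (forall u : S,
     (is_elementary X u /\ u != szero) <-> is_atom (generated X) u).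
Proof.
move=> e f E_notin E_in.
have neE := ((admissibleP X E).1 hE).1; have neF := ((admissibleP X F).1 hF).1.
have subE (E' : {fset S}) : E' `<=` E -> admissible X E'.
  move=> /fsubsetP E'E; apply/admissibleP; split=> [u /E'E/neE//|u v uE vE].
  by apply: ((admissibleP X E).1 hE).2; apply: E'E.
have memE u : nonzero_elementary X u -> u ≼ e <-> u \in E by exact: le_fjoinS.
have memF u : nonzero_elementary X u -> u ≼ f <-> u \in F by exact: le_fjoinS.
(* Membership in the image of [F] becomes a condition on [u ⋏ f], so that [e ⋏ f] and [e ∖ f] can be
   compared on atoms. *)
have mem_in u : (u \in E_in) = (u \in E) && (u ⋏ f != szero).
  by rewrite !inE; case: (boolP (u \in E)) => // /neE neu; rewrite (piD_imageP neF).
have mem_notin u : (u \in E_notin) = (u \in E) && (u ⋏ f == szero).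
  rewrite !inE; case: (boolP (u \in E)) => // /neE neu.
  by rewrite (piD_imageP neF) // negbK.
have ge : generated X e by exact: admissible_generated.
have gf : generated X f by exact: admissible_generated.
have [gand gor gdiff gcap] := (subalgebra_generated X).2 _ _ ge gf.
have adm_in : admissible X E_in.
  by apply: subE; apply/fsubsetP => u; rewrite mem_in => /andP[].
have adm_notin : admissible X E_notin.
  by apply: subE; apply/fsubsetP => u; rewrite mem_notin => /andP[].
have adm_cap : admissible X (E `&` F) by apply: subE; exact: fsubsetIl.
have diffE : e ∖ f = fjoinS E_notin.
  apply: eq_atoms_below gdiff (admissible_generated adm_notin) _ => u neu.
  rewrite sle_sdiff memE // (le_fjoinS adm_notin neu) mem_notin.
  by split=> [[-> ->]|/andP[-> /eqP ->]]; rewrite ?eqxx.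
have adm_or : admissible X (E_notin `|` F).
  apply/admissibleP; split=> [u|u v].
    by rewrite in_fsetU => /orP[|/neF//]; rewrite mem_notin => /andP[/neE].
  have cross a b : a \in E_notin -> b \in F -> a ⋏ b = szero.
    by rewrite mem_notin => /andP[_ /eqP/sand_fjoinS_eq0 H] /H.
  rewrite !in_fsetU => /orP[uE|uF] /orP[vE|vF].
  - exact: ((admissibleP X E_notin).1 adm_notin).2.
  - by rewrite cross ?eqxx.
  - by rewrite (sand0C (cross _ _ vE uF)) eqxx.
  - exact: ((admissibleP X F).1 hF).2.
have capE : e ⊓ f = fjoinS (E `&` F).
  apply: eq_atoms_below gcap (admissible_generated adm_cap) _ => u neu.
  rewrite sle_scap memE // memF // (le_fjoinS adm_cap neu) in_fsetI.
  by split=> [[-> ->]|/andP[]].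
have le_ef : e ≼ f <-> E `<=` F.
  split=> [ef|EF].
    apply/fsubsetP => u uE; apply/memF; first exact: neE.
    by apply: sle_trans ef; apply/memE => //; exact: neE.
  (* The intersection with [F] is all of [E], so [e] equals [e ⊓ f]. *)
  by rewrite /e -(fsetIidPl EF) -capE; exact: scap_ler.
split; first (split=> //; split=> //; split=> //).
(* Three of the five formulas are still open, those for [∖] and [⊓] being [diffE] and [capE]; the
   fourth goal holds the remaining claims, among which [le_ef] settles the order criterion. *)
4: split; [|split=> //; split; [|split; [|split]]].
- by rewrite -diffE sor_sdiff.
- apply: eq_atoms_below gor (admissible_generated adm_or) _ => u neu.
  rewrite (le_sor _ neu gf) diffE (le_fjoinS adm_notin neu) memF //.
  rewrite (le_fjoinS adm_or neu) in_fsetU.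
  by split=> [|/orP//]; move/orP.
- apply: eq_atoms_below gand (admissible_generated adm_in) _ => u neu.
  rewrite sle_sand memE // (le_fjoinS adm_in neu) mem_in.
  split=> [[-> ->]|/andP[-> n0]]; first by case: neu.
  by have [E0|//] := nonzero_elementary_sand neu gf; rewrite E0 eqxx in n0.
- move=> x gx; exists (atoms_below X x); first exact: atoms_below_admissible.
  by rewrite fjoinS_atoms_below.
- split=> [ef|EF]; last by rewrite /e EF.
  apply/eqP; rewrite eqEfsubset; apply/andP; split.
    by apply/le_ef; rewrite ef sle_refl.
  apply/fsubsetP => u uF; apply/memE; first exact: neF.
  by rewrite ef; apply/memF => //; exact: neF.
(* Every element of the subalgebra is the join of one of the finitely many subsets of
   [elementary_fset X]. *)
- apply: (sub_finite_set _ (finite_fset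
    [fset fjoinS G | G in fpowerset (elementary_fset X)])) => x gx.
  apply/imfsetP; exists (atoms_below X x); rewrite ?fjoinS_atoms_below //=.
  rewrite fpowersetE; apply/fsubsetP => u /mem_atoms_below[[elu _] _].
  exact: mem_elementary_fset.
- move=> x G gx admG -> a; rewrite atom_generatedP.
  split=> [[nea]|aG]; first by rewrite (le_fjoinS admG nea).
  have nea := ((admissibleP X G).1 admG).1 a aG.
  by rewrite (le_fjoinS admG nea).
- by move=> u; rewrite atom_generatedP.
Qed.
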